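(* Given countably many non-empty Noetherian spaces $X_1, X_2, \ldots, X_n, \ldots$, the reduced sobrification rank $\mathrm{rsob}(\mathop{\triangleright}_{n=1}^{+\infty} X_n)$ is equal to: 1. $\left(\bigoplus_{n=1}^k \mathrm{rsob}\, X_n\right) + \omega$ if $\mathrm{rsob}\, X_n$ is finite for $n$ large enough, where $k$ is the largest index such that $\mathrm{rsob}\, X_k$ is infinite, or $0$ if there is none; 2. $\bigoplus_{n=1}^{+\infty} \mathrm{rsob}\, X_n$ otherwise.
   Context: A topological space is Noetherian if every open subset is compact (every open cover has a finite subcover; no separation is required). For a well-founded poset $P$ and $x \in P$, $\mathrm{rk}_P(x) = \sup_{x' < x} (\mathrm{rk}_P(x')+1)$ and the ordinal rank of $P$ is $|P| = \sup_{x \in P} (\mathrm{rk}_P(x)+1)$, where $\sup\emptyset = 0$. A closed subset $C$ of $X$ is irreducible if it is non-empty and, whenever $C \subseteq F_1 \cup F_2$ with $F_1, F_2$ closed in $X$, we have $C \subseteq F_1$ or $C \subseteq F_2$. $\mathcal{S} X$ is the poset of irreducible closed subsets of $X$, ordered by inclusion (well-founded when $X$ is Noetherian). The sobrification rank of a Noetherian space $X$ is $\mathrm{sob}\, X = |\mathcal{S} X|$. When $X$ is non-empty, $\mathrm{sob}\, X$ is a successor ordinal and the reduced sobrification rank $\mathrm{rsob}\, X$ is $\mathrm{sob}\, X - 1$ (the ordinal whose successor is $\mathrm{sob}\, X$). The space $\mathop{\triangleright}_{n=1}^{+\infty} X_n$ of heterogeneous words is the set of all tuples $w = x_1 x_2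 \cdots x_m \in X_1 \times \cdots \times X_m$, with $m \in \mathbb{N}$ arbitrary (including the empty tuple $\epsilon$, $m=0$); $|w| = m$ is the length of $w$. It has the prefix topology, defined as follows. A telescope is a sequence $\mathcal{U} = U_0, U_1, \ldots, U_n, \ldots$ where $U_n$ is open in $\prod_{i=1}^n X_i$ for each $n \in \mathbb{N}$ (with $\prod_{i=1}^0 X_i = \{\epsilon\}$) and $U_n \times X_{n+1} \subseteq U_{n+1}$ for every $n \in \mathbb{N}$. It is a wide telescope if $U_n = \prod_{i=1}^n X_i$ for some $n \in \mathbb{N}$. The open sets of the prefix topology are the empty set and all the sets $\lfloor \mathcal{U} \rfloor = \{w \mid w \in U_{|w|}\}$, where $\mathcal{U}$ is a wide telescope. This space is Noetherian when all $X_n$ are. $\oplus$ is the natural (Hessenberg) sum of ordinals, an empty natural sum is $0$, and $\bigoplus_{n=1}^{+\infty} \alpha_n$ is the least upper bound of the ordinals $\bigoplus_{i=1}^n \alpha_i$, $n \in \mathbb{N}$. The operation $+$ is ordinary ordinal addition. *)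

(* Defs.v *)
From HB Require Import structures.
From mathcomp Require Import all_boot all_order all_algebra.
From mathcomp Require Import all_classical topology.

Set Implicit Arguments.
Unset Strict Implicit.
Unset Printing Implicit Defensive.

Local Open Scope classical_set_scope.

(* Ordinals are represented by well-founded trees: [lsup f] is the least
   ordinal strictly above all the [f x], that is, sup_x (f x + 1).  Distinct
   trees may denote the same ordinal, so equality of ordinals is [oeq]. *)
Inductive Ord : Type := lsup (A : Type) (f : A -> Ord).

Definition obranch (a : Ord) : Type := let: @lsup A _ := a in A.
Definition osub (a : Ord) : obranch a -> Ord := let: lsup _ f := a in f.

(* a <= b iff every f x < b, and c < lsup g iff c <= g y for some y. *)
Fixpoint ole (a b : Ord) {struct a} : Prop :=
  let: lsup _ f := a in
  forall x, exists y : obranch b, ole (f x) (osub y).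

Definition oeq (a b : Ord) : Prop := ole a b /\ ole b a.

Definition ozero : Ord := lsup (fun e : Empty_set => match e with end).
Definition osucc (a : Ord) : Ord := lsup (fun _ : unit => a).
Definition onat (n : nat) : Ord := iter n osucc ozero.
Definition omega : Ord := lsup onat.
Definition ofinite (a : Ord) : Prop := exists n, oeq a (onat n).

(* The least upper bound (not strict): the ordinals below it are those below
   some [f x]. *)
Definition osup (A : Type) (f : A -> Ord) : Ord :=
  lsup (fun p : {x : A & obranch (f x)} => osub (projT2 p)).

(* The supremum of the ordinals strictly below [a]: this is b when a = b + 1
   (see [opred_unique]), and [a] itself when [a] is not a successor. *)
Definition opred (a : Ord) : Ord := osup (@osub a).

(* a + b = sup {a, (a + b') + 1 | b' < b}, where
   a = sup {a' + 1 | a' < a}. *)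
Fixpoint oadd (a b : Ord) {struct b} : Ord :=
  let: @lsup B g := b in
  lsup (fun s : obranch a + B =>
          match s with inl x => osub x | inr y => oadd a (g y) end).

(* Natural (Hessenberg) sum, by its usual recursive definition:
   a (+) b is the least ordinal strictly above all the a' (+) b with a' < a
   and all the a (+) b' with b' < b. *)
Fixpoint onsum (a : Ord) : Ord -> Ord :=
  let: @lsup A f := a in
  fix onsum_a (b : Ord) : Ord :=
    let: @lsup B g := b in
    lsup (fun s : A + B =>
            match s with inl x => onsum (f x) b | inr y => onsum_a (g y) end).

Lemma ole_refl a : ole a a.
Proof. by elim: a => A f IH x; exists x; exact: IH. Qed.

Lemma ole_trans b a c : ole a b -> ole b c -> ole a c.
Proof.
elim: a b c => A f IH [B g] [C h] /= ab bc x.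
by have [y fg] := ab x; have [z gh] := bc y; exists z; apply: IH fg gh.
Qed.

Lemma ole_sub a (x : obranch a) : ole (osub x) a.
Proof.
elim: a x => A f IH /= x.
suff : forall b, ole b (f x) -> (forall z : obranch b, ole (osub z) b) ->
  ole b (lsup f) by apply; [exact: ole_refl | exact: IH].
by move=> [B g] bf IHb z; exists x; apply: ole_trans (IHb z) bf.
Qed.

Lemma opred_unique a b : oeq a (osucc b) -> oeq (opred a) b.
Proof.
move=> [ab ba]; split.
  case: a ab {ba} => A f /= ab [x y] /=.
  have [_ {ab}] := ab x; case: (f x) y => C h y /(_ y) [z hz].
  by exists z.
have [x bx] : exists x : obranch a, ole b (osub x) by exact: (ba tt).
apply: ole_trans bx _; rewrite /opred /osup.
case: a x {ab ba} => A f /= x.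
suff : forall c (k : obranch c -> obranch (f x)),
  (forall z, osub (k z) = osub z) -> ole c (osup f).
  by move=> H; apply: (H _ id).
move=> [C h] k kE z; exists (existT _ x (k z)) => /=.
by rewrite kE; exact: ole_refl.
Qed.

Fixpoint acc_rank (T : Type) (R : T -> T -> Prop) (x : T) (a : Acc R x)
    {struct a} : Ord :=
  lsup (fun y : {y | R y x} => acc_rank (Acc_inv a (proj2_sig y))).

(* The supremum is over all of [T] exactly when [R] is well-founded, which
   holds in the use made below (see [noetherian_wf]). *)
Definition ord_rank (T : Type) (R : T -> T -> Prop) : Ord :=
  lsup (fun x : {x | Acc R x} => acc_rank (proj2_sig x)).

Definition noetherian (X : topologicalType) : Prop :=
  forall U : set X, open U -> cover_compact U.

Definition irreducible (X : topologicalType) (C : set X) : Prop :=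
  C !=set0 /\
  forall F1 F2 : set X, closed F1 -> closed F2 ->
    C `<=` F1 `|` F2 -> C `<=` F1 \/ C `<=` F2.

Definition irr_closed (X : topologicalType) : Type :=
  {C : set X | closed C /\ irreducible C}.

Definition sob (X : topologicalType) : Ord :=
  ord_rank (fun C D : irr_closed X => sval C `<` sval D).

Lemma noetherian_wf (X : topologicalType) : noetherian X ->
  well_founded (fun C D : irr_closed X => sval C `<` sval D).
Proof.
move=> nX C0; apply: contrapT.
set R := (fun C D : irr_closed X => sval C `<` sval D) => nC0.
have [g gP] : {g : irr_closed X -> irr_closed X &
    forall C, ~ Acc R C -> R (g C) C /\ ~ Acc R (g C)}.
  apply: (@choice _ _ (fun C D => ~ Acc R C -> R D C /\ ~ Acc R D)) => C.
  have [aC|nC] := pselect (Acc R C); first by exists C.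
  apply: contrapT => H; apply: nC; constructor=> D DC.
  by apply: contrapT => nD; apply: H; exists D.
pose c n := iter n g C0.
have cN n : ~ Acc R (c n) by elim: n => [//|n /gP[]].
have cS n : R (c n.+1) (c n) by have [] := gP _ (cN n).
have c_le n m : n <= m -> sval (c m) `<=` sval (c n).
  move=> /subnK <-; elim: (m - n) => [//|k IH].
  exact: subset_trans (properW (cS (k + n))) IH.
have oc n : open (~` sval (c n)) by apply: closed_openC; case: (svalP (c n)).
have [|//|D _ cD] := nX (\bigcup_n ~` sval (c n)) _ nat setT
  (fun n => ~` sval (c n)) (fun n _ => oc n).
  exact: bigcup_open.
pose m := \max_(i <- finmap.enum_fset D) i.
have [_ []] := cS m; move=> x cmx; apply: contrapT => ncx.
have [|i iD] := cD x; first by exists m.+1.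
by apply; apply: (c_le i m) cmx; apply: leq_bigmax_seq.
Qed.

Definition rsob (X : topologicalType) : Ord := opred (sob X).

(* Indices start from 0: [X i] is the (i+1)-st space and [hprod X n] is the
   product of the first [n] spaces, with the product topology. *)
Definition hprod (X : nat -> topologicalType) (n : nat) : Type :=
  prod_topology (fun i : 'I_n => X i).

HB.instance Definition _ (X : nat -> topologicalType) (n : nat) :=
  Topological.copy (hprod X n) (prod_topology (fun i : 'I_n => X i)).

Definition hrestr (X : nat -> topologicalType) (n : nat) (w : hprod X n.+1) :
    hprod X n :=
  fun i : 'I_n => w (widen_ord (leqnSn n) i).

Definition telescope (X : nat -> topologicalType)
    (U : forall n, set (hprod X n)) : Prop :=
  (forall n, open (U n)) /\
  (forall n (w : hprod X n.+1), U n (hrestr w) -> U n.+1 w).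

Definition wide_telescope (X : nat -> topologicalType)
    (U : forall n, set (hprod X n)) : Prop :=
  telescope U /\ exists n, U n = setT.

Definition hword (X : nat -> topologicalType) : Type := {n : nat & hprod X n}.

Definition tfloor (X : nat -> topologicalType)
    (U : forall n, set (hprod X n)) : set (hword X) :=
  [set w | U (projT1 w) (projT2 w)].

Definition prefix_open (X : nat -> topologicalType) (A : set (hword X)) :
    Prop :=
  A = set0 \/ exists2 U, wide_telescope U & A = tfloor U.

HB.instance Definition _ (X : nat -> topologicalType) :=
  gen_eqMixin (hword X).
HB.instance Definition _ (X : nat -> topologicalType) :=
  gen_choiceMixin (hword X).

Section PrefixTopology.
Variable X : nat -> topologicalType.

Lemma prefix_openT : prefix_open [set: hword X].
Proof.
right; exists (fun n => setT) => //.
by split; [split=> [n|//]; exact: openT | exists 0].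
Qed.

Lemma wide_telescope_ge (U : forall n, set (hprod X n)) n m :
  telescope U -> U n = setT -> n <= m -> U m = setT.
Proof.
move=> [_ tU] Un /subnK <-; elim: (m - n) => [//|k IH].
by apply/seteqP; split=> // w _; apply: (tU (k + n) w); rewrite IH.
Qed.

Lemma prefix_openI : setI_closed (@prefix_open X).
Proof.
move=> A B [->|[U [tU [n Un]] ->]]; first by left; rewrite set0I.
move=> [->|[V [tV [m Vm]] ->]]; first by left; rewrite setI0.
right; exists (fun k => U k `&` V k); last by [].
split; first split=> [k|k w [Uw Vw]].
- by apply: openI; [apply: tU.1 | apply: tV.1].
- by split; [apply: tU.2 | apply: tV.2].
exists (maxn n m); rewrite (wide_telescope_ge tU Un (leq_maxl n m)).
by rewrite (wide_telescope_ge tV Vm (leq_maxr n m)) setIT.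
Qed.

Lemma prefix_open_bigU (I : Type) (f : I -> set (hword X)) :
  (forall i, prefix_open (f i)) -> prefix_open (\bigcup_i f i).
Proof.
move=> fo; have [[i0 fi0]|fN] := pselect (exists i, f i != set0); last first.
  left; apply/seteqP; split=> // w [i _ fiw]; case: fN; exists i.
  by apply/set0P; exists w.
right; exists (fun n => \bigcup_i (existT _ n @^-1` f i)); last first.
  by apply/seteqP; split=> -[n w].
split; first split.
- move=> n; apply: bigcup_open => i _.
  case: (fo i) => [->|[U wU ->]]; first by rewrite preimage_set0; exact: open0.
  exact: wU.1.1.
- move=> n w [i _ /= fiw]; exists i => //=; move: fiw.
  case: (fo i) => [->//|[U wU ->]]; exact: wU.1.2.
case: (fo i0) => [fi00|[U wU fE]]; first by rewrite fi00 eqxx in fi0.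
case: wU => tU [n Un]; exists n; apply/seteqP; split=> // w _.
by exists i0 => //=; rewrite fE /tfloor /= Un.
Qed.

End PrefixTopology.

HB.instance Definition _ (X : nat -> topologicalType) :=
  isOpenTopological.Build (hword X)
    (@prefix_openT X) (@prefix_openI X) (@prefix_open_bigU X).

Lemma hword_openE (X : nat -> topologicalType) :
  (@open (hword X)) = @prefix_open X.
Proof. by []. Qed.

(* Main.v *)
Require Import Defs.
From mathcomp Require Import all_boot all_order all_algebra.
From mathcomp Require Import all_classical topology.

(** The irreducible closed subsets of the word space are the whole space and
the boxes: for irreducible closed [C i] in [X i] and a length [m], the box is
the set of words of length at most [m] whose [i]-th letter is in [C i]
([box_irreducible], [irreducible_box]).  Indeed a closed set other than the
whole space has words of bounded length, so that the condition that the
[i]-th letter lies in an open set becomes open once the too long words are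
added to it ([open_letter_in]); an irreducible set that meets finitely many
such sets meets their intersection, and this forces it to be a box.

Boxes are compared by length and by factors, so replacing [C i] by a smaller
[D i] gives a smaller box, and so does shortening it.  Hence the rank of a box
is at least the natural sum of the ranks of its factors, which is the
recursive definition of that sum ([rank_box_ge]).  It is at most the natural
sum of the successors of these ranks, since this is a strictly increasing
function of the box ([box_measure_lt]); and that sum exceeds the first one by
[m] at most ([onsums_succ]).

The reduced sobrification rank of [X i] is the rank of some irreducible closed
subset: this uses that [X i] is Noetherian ([rsob_attained]), and matters
because natural sums do not commute with limits.  That of the word space is
the rank of the whole space, that is, the least ordinal strictly above the
ranks of all boxes.  A box can be lengthened, which raises its rank, so this
is the least ordinal strictly above all the finite successors of the natural
sums of the first [m] of the ordinals [rsob (X i)], for all [m]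
([rsob_hword_bounds]).  When the ordinals [rsob (X i)] are finite from [k] on,
each of these sums is bounded by a finite successor of the [k]-th one, and the
bound is that sum plus [omega] ([onsums_finite]).  Otherwise, every sum is
followed by one with a further infinite term, so the finite successors
disappear in the supremum ([onsums_infinite]). *)

Set Implicit Arguments.
Unset Strict Implicit.
Unset Printing Implicit Defensive.

Local Open Scope classical_set_scope.

(** * Order and natural sum of ordinals *)

Definition olt (a b : Ord) : Prop := exists x : obranch b, ole a (osub x).

Lemma ole_olt_trans b a c : ole a b -> olt b c -> olt a c.
Proof. by move=> ab [x bx]; exists x; apply: ole_trans bx. Qed.

Lemma olt_ole_trans b a c : olt a b -> ole b c -> olt a c.
Proof.
case: b => B g [x ax] /(_ x) [y xy]; exists y; exact: ole_trans xy.
Qed.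

Lemma oltW a b : olt a b -> ole a b.
Proof. by move=> [x ax]; apply: ole_trans ax (ole_sub _). Qed.

Lemma olt_sub a (x : obranch a) : olt (osub x) a.
Proof. by exists x; exact: ole_refl. Qed.

Lemma ole_lt a b : (forall c, olt c a -> olt c b) -> ole a b.
Proof. by case: a => A f H x; apply: H; exact: olt_sub. Qed.

(** The order on trees is total only classically: if [a] is not below [b], some
branch of [a] is not below any branch of [b], hence above all of them. *)
Lemma ole_or_olt a b : ole a b \/ olt b a.
Proof.
suff H : ~ ole a b -> olt b a.
  by have [|/H] := pselect (ole a b); [left|right].
elim: a b => A f IH b nab; apply: contrapT => nba; apply: nab => x /=.
apply: contrapT => nxb; apply: nba; exists x; apply: ole_lt => c [y cy].
by apply: ole_olt_trans cy _; apply: IH => xy; apply: nxb; exists y.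
Qed.

Lemma ole0 a : ole ozero a. Proof. by case. Qed.

Lemma olt_succP a b : olt a (osucc b) <-> ole a b.
Proof. by split=> [[[]]|ab]; last exists tt. Qed.

Lemma ole_succP a b : ole (osucc a) b <-> olt a b.
Proof. by split=> [/(_ tt)|ab []]. Qed.

Lemma ole_succ2 a b : ole a b -> ole (osucc a) (osucc b).
Proof. by move=> ab; apply/ole_succP/olt_succP. Qed.

Lemma ole_iter_succ n a b : ole a b -> ole (iter n osucc a) (iter n osucc b).
Proof. by move=> ab; elim: n => //= n; exact: ole_succ2. Qed.

Lemma olt_osupP (A : Type) (f : A -> Ord) a :
  olt a (osup f) <-> exists x, olt a (f x).
Proof.
split=> [[[x y] /= ay]|[x [y ay]]]; first by exists x, y.
by exists (existT _ x y).
Qed.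

(** The nested fixpoint defining [onsum] reduces only on constructors; this
form is symmetric in its arguments and applies to variables. *)
Lemma onsumE a b : onsum a b = lsup (fun s : obranch a + obranch b =>
  match s with inl x => onsum (osub x) b | inr y => onsum a (osub y) end).
Proof. by case: a; case: b. Qed.

Lemma ole_onsum a a' b b' :
  ole a a' -> ole b b' -> ole (onsum a b) (onsum a' b').
Proof.
elim: a a' b b' => A f IHa a' b; elim: b => B g IHb b' aa' bb'.
rewrite !onsumE => -[x|y].
  by have [x' xx'] := aa' x; exists (inl x'); exact: IHa.
by have [y' yy'] := bb' y; exists (inr y'); exact: IHb.
Qed.

Lemma olt_onsumP a b c : olt c (onsum a b) <->
  (exists2 a', olt a' a & ole c (onsum a' b)) \/
  (exists2 b', olt b' b & ole c (onsum a b')).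
Proof.
rewrite onsumE; split=> [[[x|y] cx]|[[a' [x ax] ca]|[b' [y bY] cb]]].
- by left; exists (osub x) => //; exact: olt_sub.
- by right; exists (osub y) => //; exact: olt_sub.
- by exists (inl x); apply: ole_trans ca (ole_onsum ax (ole_refl b)).
- by exists (inr y); apply: ole_trans cb (ole_onsum (ole_refl a) bY).
Qed.

Lemma olt_onsuml a a' b b' :
  olt a a' -> ole b b' -> olt (onsum a b) (onsum a' b').
Proof.
move=> aa' bb'; apply/olt_onsumP; left; exists a => //.
exact/ole_onsum/bb'/ole_refl.
Qed.

Lemma olt_onsumr a a' b b' :
  ole a a' -> olt b b' -> olt (onsum a b) (onsum a' b').
Proof.
move=> aa' bb'; apply/olt_onsumP; right; exists b => //.
exact/ole_onsum/ole_refl.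
Qed.

Lemma onsum0l b : ole (onsum ozero b) b.
Proof.
elim: b => B g IH; apply: ole_lt => c /olt_onsumP[[a' []]//|[b' [y by_] cb]].
exists y; apply: ole_trans cb (ole_trans _ (IH y)).
by apply: ole_onsum by_; exact: ole_refl.
Qed.

Lemma ole_onsumEl a b : ole a (onsum a b).
Proof.
elim: a => A f IH; apply: ole_lt => c [x cx]; apply/olt_onsumP; left.
by exists (f x); [exact: (@olt_sub (lsup f))|exact: ole_trans (IH x)].
Qed.

Lemma ole_onsumEr a b : ole b (onsum a b).
Proof.
elim: b => B g IH; apply: ole_lt => c [y cy]; apply/olt_onsumP; right.
by exists (g y); [exact: (@olt_sub (lsup g))|exact: ole_trans (IH y)].
Qed.

Lemma ole_iter_onsumr n a b :
  ole (iter n osucc (onsum a b)) (onsum a (iter n osucc b)).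
Proof.
elim: n => [|n IH] /=; first exact: ole_refl.
apply/ole_succP/olt_onsumP; right; exists (iter n osucc b) => //.
by apply/olt_succP; exact: ole_refl.
Qed.

Lemma onsum_succl a b : ole (onsum (osucc a) b) (osucc (onsum a b)).
Proof.
elim: b => B g IH; apply: ole_lt => c /olt_onsumP[[a' /olt_succP aa ca]|].
  apply/olt_succP/(ole_trans ca)/ole_onsum => //; exact: ole_refl.
move=> [b' [y bY] cb]; apply/olt_succP/(ole_trans cb).
apply: ole_trans (ole_onsum (ole_refl _) bY) (ole_trans (IH y) _).
by apply/ole_succP/olt_onsumr; [exact: ole_refl|exact: olt_sub].
Qed.

Lemma onsum_succr a b : ole (onsum a (osucc b)) (osucc (onsum a b)).
Proof.
elim: a => A f IH; apply: ole_lt => c.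
move=> /olt_onsumP[|[b' /olt_succP bb cb]]; last first.
  apply/olt_succP/(ole_trans cb)/ole_onsum => //; exact: ole_refl.
move=> [a' [x ax] ca]; apply/olt_succP/(ole_trans ca).
apply: ole_trans (ole_onsum ax (ole_refl _)) (ole_trans (IH x) _).
by apply/ole_succP/olt_onsuml; [exact: olt_sub|exact: ole_refl].
Qed.

Lemma onsum_iterl n a b :
  ole (onsum (iter n osucc a) b) (iter n osucc (onsum a b)).
Proof.
elim: n => [|n IH] /=; first exact: ole_refl.
exact/(ole_trans (onsum_succl _ _))/ole_succ2.
Qed.

Lemma onsum_iterr n a b :
  ole (onsum a (iter n osucc b)) (iter n osucc (onsum a b)).
Proof.
elim: n => [|n IH] /=; first exact: ole_refl.
exact/(ole_trans (onsum_succr _ _))/ole_succ2.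
Qed.

(** [a + omega] is the limit of the [a + n], and [a + n] is the [n]-th
successor of [a]. *)
Lemma ole_oadd_omega a b :
  ole (oadd a omega) b <-> forall n, olt (iter n osucc a) b.
Proof.
have addE n : oeq (oadd a (onat n)) (iter n osucc a).
  elim: n => [|n [IH1 IH2]] /=.
    split; first by apply: ole_lt => c [[x cx|[]]]; exists x.
    by apply: ole_lt => c [x cx]; exists (inl x).
  split; apply: ole_lt => c.
    case=> -[x /= cx|[] cn]; apply/olt_succP; last exact: ole_trans IH1.
    apply: (ole_trans cx).
    elim: n {IH1 IH2} => [|n IH] /=; first exact: ole_sub.
    by apply: (ole_trans IH); apply: oltW; apply/olt_succP; exact: ole_refl.
  by move/olt_succP => cn; exists (inr tt); apply: ole_trans cn IH2.
split=> [ab n|H].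
  apply: olt_ole_trans ab; exists (inr n); exact: (addE n).2.
apply: ole_lt => c [[x|n] /= cx]; apply: ole_olt_trans cx _.
  exact: olt_ole_trans (olt_sub x) (oltW (H 0)).
exact: ole_olt_trans (addE n).1 (H n).
Qed.

Lemma onat_ole_infinite a n : ~ ofinite a -> ole (onat n) a.
Proof.
move=> ia; elim: n => [|n IH]; first exact: ole0.
have [a_n|] := ole_or_olt a (onat n); last by move/ole_succP.
by case: ia; exists n.
Qed.

(** Taking a sequence indexed by all natural numbers, and not by ['I_n],
lets the sum be unfolded from its first term by shifting the sequence. *)
Definition onsums (a : nat -> Ord) n : Ord := \big[onsum/ozero]_(i < n) a i.

Lemma onsums0 a : onsums a 0 = ozero.
Proof. by rewrite /onsums big_ord0. Qed.

Lemma onsumsS a n : onsums a n.+1 = onsum (a 0) (onsums (a \o S) n).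
Proof. by rewrite /onsums big_ord_recl. Qed.

Lemma ole_onsums a b n m : (n <= m)%N ->
  (forall i, (i < n)%N -> ole (a i) (b i)) -> ole (onsums a n) (onsums b m).
Proof.
elim: n a b m => [|n IH] a b m nm ab; first by rewrite onsums0; exact: ole0.
case: m nm => // m nm; rewrite !onsumsS.
by apply: ole_onsum; [exact: ab|apply: IH => // i; exact: (ab i.+1)].
Qed.

Lemma olt_onsums a b n m : (n <= m)%N ->
  (forall i, (i < n)%N -> ole (a i) (b i)) ->
  (exists2 i, (i < n)%N & olt (a i) (b i)) -> olt (onsums a n) (onsums b m).
Proof.
elim: n a b m => [|n IH] a b [|m] // nm ab [i i_n abi] //.
rewrite !onsumsS; case: i => [|i] in i_n abi *.
  by apply: olt_onsuml abi _; apply: ole_onsums => // j; exact: (ab j.+1).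
apply: olt_onsumr; first exact: ab.
by apply: IH => // [j|]; [exact: (ab j.+1)|exists i].
Qed.

Lemma olt_onsums_ltn a b n m : (n < m)%N ->
  (forall i, (i < n)%N -> ole (a i) (b i)) ->
  (forall i, olt ozero (b i)) -> olt (onsums a n) (onsums b m).
Proof.
elim: n a b m => [|n IH] a b [|m] // nm ab b0.
  by rewrite onsums0 onsumsS; apply: olt_ole_trans (b0 0) (ole_onsumEl _ _).
rewrite !onsumsS; apply: olt_onsumr; first exact: ab.
by apply: IH => // i; [exact: (ab i.+1)|exact: (b0 i.+1)].
Qed.

(** What lies below a natural sum of [n] terms is obtained by decreasing a
single term.  The decreased sequence is described by the inequalities that it
satisfies, rather than built, so that it can later be taken to be any sequence
of ranks. *)
Lemma olt_onsumsP a n c : olt c (onsums a n) -> exists i a',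
  [/\ (i < n)%N, olt a' (a i) &
    forall b, ole a' (b i) -> (forall j, j != i -> ole (a j) (b j)) ->
      ole c (onsums b n)].
Proof.
elim: n a c => [|n IH] a c; first by rewrite onsums0 => -[[]].
rewrite onsumsS => /olt_onsumP[[a' a'a ca']|[d /IH[i [a' [i_n a'a da]] cd]]].
  exists 0, a'; split=> // b a'b ab; rewrite onsumsS; apply: (ole_trans ca').
  by apply: ole_onsum a'b _; apply: ole_onsums => // j _; exact: ab.
exists i.+1, a'; split=> // b a'b ab; rewrite onsumsS; apply: (ole_trans cd).
by apply: ole_onsum; [exact: ab|apply: da => // j ji; exact: ab].
Qed.

Lemma onsums_succ a n :
  ole (onsums (osucc \o a) n) (iter n osucc (onsums a n)).
Proof.
elim: n a => [|n IH] a; first by rewrite !onsums0; exact: ole_refl.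
rewrite !onsumsS; apply: ole_trans (onsum_succl _ _) _; apply: ole_succ2.
apply: ole_trans (onsum_iterr _ _ _).
apply: ole_onsum; [exact: ole_refl|exact: IH].
Qed.

(** An infinite term absorbs any finite number of successors of the terms that
come before it. *)
Lemma onsums_infinite a n m p : (n <= m)%N -> ~ ofinite (a m) ->
  ole (iter p osucc (onsums a n)) (onsums a m.+1).
Proof.
move=> + am; elim: n m a am => [|n IH] m a am nm.
  rewrite onsums0; apply: (ole_trans (onat_ole_infinite p am)).
  elim: m a {am nm} => [|m IHm] a; rewrite onsumsS; first exact: ole_onsumEl.
  exact: ole_trans (IHm (a \o S)) (ole_onsumEr _ _).
case: m nm am => // m nm am; rewrite !(onsumsS a).
apply: ole_trans (ole_iter_onsumr _ _ _) _.
by apply: ole_onsum; [exact: ole_refl|exact: IH].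
Qed.

(** The finite terms from the [k]-th on can be pulled out of the sum as
successors. *)
Lemma onsums_finite a k n : (forall i, (k <= i)%N -> ofinite (a i)) ->
  exists p, ole (onsums a n) (iter p osucc (onsums a k)).
Proof.
elim: k n a => [|k IH] n a fa.
  rewrite onsums0; elim: n a fa => [|n IHn] a fa.
    by exists 0; rewrite onsums0; exact: ole0.
  have [|q hq] := IHn (a \o S); first by move=> i _; exact: fa.
  have [p [hp _]] := fa 0 (leqnn _); exists (p + q)%N; rewrite onsumsS iterD.
  apply: ole_trans (ole_onsum hp hq) (ole_trans (onsum_iterl _ _ _) _).
  exact/ole_iter_succ/onsum0l.
case: n => [|n]; first by exists 0; rewrite onsums0; exact: ole0.
have [i|p hp] := IH n (a \o S); first exact: (fa i.+1).
exists p; rewrite !(onsumsS a); apply: ole_trans (onsum_iterr _ _ _).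
by apply: ole_onsum; [exact: ole_refl|exact: hp].
Qed.

(** * Ranks in well-founded relations *)

Section Rank.
Variables (T : Type) (R : T -> T -> Prop).

Lemma acc_rankE x (ax : Acc R x) : acc_rank ax =
  lsup (fun y : {y | R y x} => acc_rank (Acc_inv ax (proj2_sig y))).
Proof. by case: ax. Qed.

Lemma acc_rank_mono x y (ax : Acc R x) (ay : Acc R y) :
  R y x -> olt (acc_rank ay) (acc_rank ax).
Proof.
move=> yx; rewrite (acc_rankE ax); exists (exist _ y yx) => /=.
by rewrite (Prop_irrelevance ay (Acc_inv ax yx)); exact: ole_refl.
Qed.

Lemma olt_acc_rankP x (ax : Acc R x) c : olt c (acc_rank ax) ->
  exists y (ay : Acc R y), R y x /\ ole c (acc_rank ay).
Proof.
by rewrite acc_rankE => -[[y yx] /= cy]; exists y, (Acc_inv ax yx).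
Qed.

(** A strictly decreasing measure with ordinal values gives accessibility, and
bounds the rank.  The measure is a relation, since the boxes that will be
measured do not determine the families of factors that they come from. *)
Lemma acc_measure (Q : T -> Ord -> Prop) :
  (forall x y a, Q x a -> R y x -> exists2 b, Q y b & olt b a) ->
  forall x a, Q x a -> Acc R x.
Proof.
move=> QR x a Qx; have := ole_refl a; move: {2}a => c; elim: c a x Qx.
move=> A f IH a x Qx ac; constructor=> y yx.
have [b Qy ba] := QR _ _ _ Qx yx.
have [z bz] := olt_ole_trans ba ac; exact: IH Qy bz.
Qed.

Lemma acc_rank_measure (Q : T -> Ord -> Prop) :
  (forall x y a, Q x a -> R y x -> exists2 b, Q y b & olt b a) ->
  forall x a (ax : Acc R x), Q x a -> ole (acc_rank ax) a.
Proof.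
move=> QR x a ax Qx; have := ole_refl a; move: {2}a => c; elim: c a x ax Qx.
move=> C f IH a x ax Qx ac; apply: ole_lt => d.
move=> /olt_acc_rankP[y [ay [yx dy]]]; apply: (ole_olt_trans dy).
have [b Qy ba] := QR _ _ _ Qx yx.
have [z bz] := olt_ole_trans ba ac.
exact: ole_olt_trans (IH z _ _ ay Qy bz) ba.
Qed.

(** An element of greatest rank makes the rank of the relation a successor. *)
Lemma opred_ord_rank t (at_ : Acc R t) :
  (forall x (ax : Acc R x), ole (acc_rank ax) (acc_rank at_)) ->
  oeq (opred (ord_rank R)) (acc_rank at_).
Proof.
move=> tmax; apply: opred_unique; split.
  by move=> [x ax]; exists tt; exact: tmax.
by move=> []; exists (exist _ t at_); exact: ole_refl.
Qed.

Lemma ole_opred_ord_rank x (ax : Acc R x) :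
  ole (acc_rank ax) (opred (ord_rank R)).
Proof.
apply: ole_lt => c cx; by apply/olt_osupP; exists (exist _ x ax).
Qed.

End Rank.

(** * Irreducible closed sets of a Noetherian space *)

Section Irreducible.
Variable X : topologicalType.

(** Without a minimal element there is a strictly decreasing sequence of closed
sets; the union of their complements is open, and no finite number of them
covers it. *)
Lemma noetherian_minimal_closed (P : set (set X)) :
  noetherian X -> P `<=` closed -> P !=set0 ->
  exists2 F, P F & forall G, P G -> G `<=` F -> G = F.
Proof.
move=> nX Pcl [F0 PF0]; apply: contrapT => nomin.
have [g gP] : {g : set X -> set X & forall F, P F -> P (g F) /\ g F `<` F}.
  apply: (@choice _ _ (fun F G => P F -> P G /\ G `<` F)) => F.
  have [PF|] := pselect (P F); last by exists F.
  apply: contrapT => H; apply: nomin; exists F => // G PG GF.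
  apply/seteqP; split=> //; apply: contrapT => FG.
  by apply: H; exists G => _; split=> //; split.
pose c n := iter n g F0.
have Pc n : P (c n) by elim: n => //= n /gP[].
have c_le n m : (n <= m)%N -> c m `<=` c n.
  move=> /subnK <-; elim: (m - n)%N => [//|k IH].
  exact: subset_trans (properW (gP _ (Pc _)).2) IH.
have oc n : open (~` c n) by apply: closed_openC; exact: Pcl.
have [|//|D _ cD] := nX (\bigcup_n ~` c n) _ nat setT
  (fun n => ~` c n) (fun n _ => oc n); first exact: bigcup_open.
pose m := \max_(i <- finmap.enum_fset D) i.
have [_ [_ nsub]] := gP _ (Pc m); apply: nsub => x cmx; apply: contrapT => ncx.
have [i iD] := cD x (ex_intro2 _ _ m.+1 I ncx).
by apply; apply: (c_le i m) cmx; exact: leq_bigmax_seq.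
Qed.

Lemma irreducible_openP (C : set X) : irreducible C <-> C !=set0 /\
  forall U V, open U -> open V -> C `&` U !=set0 -> C `&` V !=set0 ->
    C `&` (U `&` V) !=set0.
Proof.
split=> -[C0 H]; split=> //.
  move=> U V oU oV [x [Cx Ux]] [y [Cy Vy]]; apply: contrapT => UV0.
  have [| | |/(_ x Cx)//|/(_ y Cy)//] := H (~` U) (~` V).
  - exact: open_closedC.
  - exact: open_closedC.
  move=> z Cz; apply/not_andP => -[Uz Vz]; apply: UV0.
  by exists z.
move=> F G cF cG CFG.
have [|CF] := pselect (C `<=` F); first by left.
have [|CG] := pselect (C `<=` G); first by right.
have meet (A : set X) : ~ C `<=` A -> C `&` ~` A !=set0.
  by move=> CA; apply/set0P/eqP => /disjoints_subset; rewrite setCK.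
have [x [Cx [nFx nGx]]] := H _ _ (closed_openC cF) (closed_openC cG)
  (meet _ CF) (meet _ CG).
by have [] := CFG x Cx.
Qed.

Lemma irreducible_bigcap (C : set X) n (U : nat -> set X) : irreducible C ->
  (forall i, (i < n)%N -> open (U i)) ->
  (forall i, (i < n)%N -> C `&` U i !=set0) ->
  exists2 x, C x & forall i, (i < n)%N -> U i x.
Proof.
move=> irrC; have [C0 CI] := (irreducible_openP C).1 irrC => oU CU.
suff [_ [x [Cx Ux]]] : open (\bigcap_(i in `I_n) U i) /\
    C `&` \bigcap_(i in `I_n) U i !=set0 by exists x.
elim: n oU CU => [|n IH] oU CU.
  by rewrite II0 bigcap_set0 setIT; split=> //; exact: openT.
have [i /ltnW|i /ltnW|oI CI'] := IH; [exact: oU|exact: CU|].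
rewrite IIS setUC bigcap_setU1; split; first by apply: openI => //; exact: oU.
by apply: CI => //; [exact: oU|exact: CU].
Qed.

Lemma irreducible_closure (A : set X) : A !=set0 ->
  (forall U V, open U -> open V -> A `&` U !=set0 -> A `&` V !=set0 ->
    A `&` (U `&` V) !=set0) ->
  irreducible (closure A).
Proof.
move=> A0 AI; have cA := @subset_closure _ A; apply/irreducible_openP; split.
  by have [x Ax] := A0; exists x; exact: cA.
have meetA U : open U -> closure A `&` U !=set0 -> A `&` U !=set0.
  by move=> oU [x [clx Ux]]; apply: clx; exact: open_nbhs_nbhs.
move=> U V oU oV /(meetA _ oU) AU /(meetA _ oV) AV.
by have [x [Ax UVx]] := AI _ _ oU oV AU AV; exists x; split=> //; exact: cA.
Qed.

Lemma irr_closed_eq (C D : irr_closed X) : sval C = sval D -> C = D.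
Proof. by apply: eq_sig_hprop => A; exact: Prop_irrelevance. Qed.

Hypothesis X_noetherian : noetherian X.

Definition irr_rank (C : irr_closed X) : Ord :=
  acc_rank (noetherian_wf X_noetherian C).

Lemma irr_rank_olt (C D : irr_closed X) :
  sval C `<` sval D -> olt (irr_rank C) (irr_rank D).
Proof. by move=> CD; rewrite /irr_rank; apply: acc_rank_mono. Qed.

Lemma irr_rank_ole (C D : irr_closed X) :
  sval C `<=` sval D -> ole (irr_rank C) (irr_rank D).
Proof.
move=> CD; have [DC|DC] := pselect (sval D `<=` sval C); last first.
  by apply/oltW/irr_rank_olt.
suff -> : C = D by exact: ole_refl.
exact/irr_closed_eq/seteqP.
Qed.

Lemma olt_irr_rank (C : irr_closed X) c : olt c (irr_rank C) ->
  exists2 D : irr_closed X, sval D `<` sval C & ole c (irr_rank D).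
Proof.
move=> clt; have [D [aD [DC cD]]] := olt_acc_rankP clt; exists D => //.
by rewrite /irr_rank (Prop_irrelevance (noetherian_wf _ _) aD).
Qed.

(** A minimal non-empty closed set in which no irreducible closed subset has
greatest rank cannot be irreducible, as it would have greatest rank itself.
So it is the union of two smaller closed sets; each has an irreducible closed
subset of greatest rank, and the larger of the two ranks is greatest in the
union. *)
Lemma rsob_attained : [set: X] !=set0 -> exists C, oeq (rsob X) (irr_rank C).
Proof.
move=> X0.
suff [C Cmax] : exists C, forall D, ole (irr_rank D) (irr_rank C).
  exists C; apply: opred_ord_rank => D aD.
  by rewrite (Prop_irrelevance aD (noetherian_wf X_noetherian D)); exact: Cmax.
pose good (F : set X) := exists2 C : irr_closed X, sval C `<=` F &
  forall D : irr_closed X, sval D `<=` F -> ole (irr_rank D) (irr_rank C).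
suff [C _ Cmax] : good setT by exists C => D; exact: Cmax.
apply: contrapT => nT.
have [||F [[clF F0] bF] minF] :=
    @noetherian_minimal_closed [set F | (closed F /\ F !=set0) /\ ~ good F]
      X_noetherian.
- by move=> F [[]].
- by exists setT; split=> //; split=> //; exact: closedT.
have goodS G : closed G -> G !=set0 -> G `<=` F -> ~ F `<=` G -> good G.
  move=> clG G0 GF nFG; apply: contrapT => bG.
  by apply: nFG; rewrite (minF G).
have nirrF : ~ irreducible F.
  move=> irrF; apply: bF; exists (exist _ F (conj clF irrF)) => //= D DF.
  exact: irr_rank_ole.
apply: nirrF; split=> // F1 F2 cl1 cl2 F12; apply: contrapT => /not_orP[n1 n2].
have I0 G1 G2 : F `<=` G1 `|` G2 -> ~ F `<=` G2 -> F `&` G1 !=set0.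
  move=> G12 nG2; apply: contrapT => /set0P/negP/negPn/eqP FG0.
  apply: nG2 => x Fx; case: (G12 x Fx) => // G1x.
  by have : (F `&` G1) x by []; rewrite FG0.
have nI (G : set X) : ~ F `<=` G -> ~ F `<=` F `&` G.
  by move=> nG; rewrite subsetI => -[].
have [C1 C1F m1] := goodS (F `&` F1) (closedI clF cl1) (I0 _ _ F12 n2)
  (@subIsetl _ _ _) (nI _ n1).
have F21 : F `<=` F2 `|` F1 by rewrite setUC.
have [C2 C2F m2] := goodS (F `&` F2) (closedI clF cl2)
  (I0 F2 F1 F21 n1) (@subIsetl _ _ _) (nI _ n2).
have split_irr (D : irr_closed X) : sval D `<=` F ->
    sval D `<=` F `&` F1 \/ sval D `<=` F `&` F2.
  move=> DF; have [_ [_ irrD]] := svalP D.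
  have [|D1|D2] := irrD F1 F2 cl1 cl2; first exact: subset_trans F12.
  - by left; rewrite subsetI.
  - by right; rewrite subsetI.
apply: bF; have [C12|/oltW C21] := ole_or_olt (irr_rank C1) (irr_rank C2).
  exists C2; first by move=> x /C2F[].
  by move=> D /split_irr[/m1 D1|/m2//]; exact: ole_trans C12.
exists C1; first by move=> x /C1F[].
by move=> D /split_irr[/m1//|/m2 D2]; exact: ole_trans C21.
Qed.

End Irreducible.

(** * Boxes in the space of heterogeneous words *)

Section Box.
Variables (I : choiceType) (T : I -> topologicalType).

(** The sets containing a box around [x] form a filter, which converges to [x]
in each coordinate, hence in the product. *)
Lemma open_prod_box (U : set (prod_topology T)) (x : prod_topology T) :
  open U -> U x -> exists V : forall i, set (T i),
    [/\ forall i, open (V i), forall i, V i (x i) &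
        forall y : prod_topology T, (forall i, V i (y i)) -> U y].
Proof.
move=> oU Ux.
pose F : set_system (prod_topology T) :=
  [set A | exists V : forall i, set (T i),
    [/\ forall i, open (V i), forall i, V i (x i) &
        forall y : prod_topology T, (forall i, V i (y i)) -> A y]].
have FF : Filter F.
  split.
  - by exists (fun=> setT); split=> // i; exact: openT.
  - move=> A B [V [oV Vx VA]] [W [oW Wx WB]]; exists (fun i => V i `&` W i).
    split=> [i|i|y VWy]; [exact: openI|by []|].
    by split; [apply: VA => i; case: (VWy i)|apply: WB => i; case: (VWy i)].
  - by move=> A B AB [V [oV Vx VA]]; exists V; split=> // y /VA /AB.
suff : F --> x by apply; exact: open_nbhs_nbhs.
apply/cvg_sup => i A; rewrite nbhsE => -[_ [[B oB <-] Bx] BA].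
have Fi : F [set y | B (y i)].
  exists (@dfwith I (fun i => set (T i)) (fun=> setT) i B); split.
  - by move=> j; case: dfwithP => // *; exact: openT.
  - by move=> j; case: dfwithP.
  - by move=> y /(_ i); rewrite dfwithin.
exact: filterS Fi.
Qed.

End Box.

Section Words.
Variable X : nat -> topologicalType.
Implicit Types (C D : forall i, set (X i)) (p : forall i, X i).

(** Letters indexed by all natural numbers avoid the dependency of a word on its
length; as the spaces are non-empty, every word has this form
([word_extend]). *)
Definition word p n : hword X := existT _ n (fun i : 'I_n => p i).

(** The projection [projT2], with a type that lets it be applied to an index. *)
Definition letter (w : hword X) : hprod X (projT1 w) := projT2 w.

Arguments letter : clear implicits.

Definition box C m : set (hword X) := [set w : hword X | (projT1 w <= m)%N /\
  forall i : 'I_(projT1 w), C i (letter w i)].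

Lemma open_proj n (i : 'I_n) (V : set (X i)) :
  open V -> open ([set w | V (w i)] : set (hprod X n)).
Proof.
by apply: open_comp => w _; exact: (@proj_continuous _ (fun j : 'I_n => X j) i).
Qed.

Lemma box_closed C m : (forall i, closed (C i)) -> closed (box C m).
Proof.
move=> clC; rewrite -openC hword_openE; right.
exists (fun n => [set w : hprod X n |
    (m < n)%N \/ exists i : 'I_n, ~ C i (w i)]); last first.
  apply/seteqP; split=> -[n w] /=.
    move=> /not_andP[/negP|/existsNP]; first by rewrite -ltnNge; left.
    by right.
  by case=> [mn|[i nCi]] [/= nm Cw]; [rewrite leqNgt mn in nm|exact/nCi/Cw].
split; last by exists m.+1; apply/seteqP; split=> // w _; left=> /=.
split=> [n|n w [mn|[i nCi]]]; last 2 first.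
- by left; exact: ltnW.
- by right; exists (widen_ord (leqnSn n) i).
have [mn|nm] := boolP (m < n)%N.
  rewrite (_ : mkset _ = setT); first exact: openT.
  by apply/seteqP; split=> // w _; left.
rewrite (_ : mkset _ = \bigcup_(i : 'I_n) [set w : hprod X n | (~` C i) (w i)]).
  by apply: bigcup_open => i _; apply: open_proj; exact: closed_openC.
apply/seteqP; split=> w; first by case=> // -[i Ci]; exists i.
by move=> [i _ Ci]; right; exists i.
Qed.

Definition letter_in i (V : set (X i)) : set (hword X) :=
  [set w : hword X |
    exists lt_i : (i < projT1 w)%N, V (letter w (Ordinal lt_i))].

(** A wide telescope contains all long words, so fixing the [i]-th letter in
[V] is an open condition only up to them. *)
Lemma open_letter_in i (V : set (X i)) L : open V ->
  open (letter_in V `|` [set w : hword X | (L < projT1 w)%N]).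
Proof.
move=> oV; rewrite hword_openE; right.
exists (fun n => [set w : hprod X n |
   (exists lt_i : (i < n)%N, V (w (Ordinal lt_i))) \/
   (L < n)%N]) => //.
split; last by exists L.+1; apply/seteqP; split=> // w _; right=> /=.
split=> [n|n w [[lt_i Vi]|Ln]]; last 2 first.
- by left; exists (widen_ord_proof (Ordinal lt_i) (leqnSn n)).
- by right; exact: ltnW.
have [Ln|nL] := pselect (is_true (L < n)%N).
  rewrite (_ : mkset _ = setT); first exact: openT.
  by apply/seteqP; split=> // w _; right.
have [lt_i|ge_i] := pselect (is_true (i < n)%N); last first.
  rewrite (_ : mkset _ = set0); first exact: open0.
  by apply/seteqP; split=> // w [[lt_i]|//]; case: (ge_i lt_i).
rewrite (_ : mkset _ = [set w : hprod X n | V (w (Ordinal lt_i))]).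
  exact: (@open_proj n (Ordinal lt_i)).
apply/seteqP; split=> w; last by left; exists lt_i.
by case=> // -[lt_i']; rewrite (bool_irrelevance lt_i' lt_i).
Qed.

(** This is the second condition on telescopes, iterated. *)
Lemma open_word (U : set (hword X)) p n m :
  open U -> (n <= m)%N -> U (word p n) -> U (word p m).
Proof.
rewrite hword_openE => -[->//|[V [[_ tV] _] ->]].
move=> /subnK <-; elim: (m - n)%N => // k IH /IH; exact: tV.
Qed.

Lemma open_word_long (U : set (hword X)) p :
  open U -> U !=set0 -> exists n, forall m, (n <= m)%N -> U (word p m).
Proof.
rewrite hword_openE => -[->[]//|[V [tV [n Vn]] ->] _].
exists n => m nm; rewrite /tfloor /=.
by rewrite (wide_telescope_ge tV Vn nm).
Qed.

(** Two non-empty open sets share all the words that are long enough. *)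
Lemma setT_irreducible : (forall i, [set: X i] !=set0) ->
  irreducible [set: hword X].
Proof.
move=> X0; pose p i := sval (cid (X0 i)).
apply/irreducible_openP; split; first by exists (word p 0).
move=> U V oU oV; rewrite !setTI => /(open_word_long p oU)[n Un].
move=> /(open_word_long p oV)[m Vm]; exists (word p (maxn n m)).
by split; [exact/Un/leq_maxl|exact/Vm/leq_maxr].
Qed.

Lemma word_extend (w : hword X) p : exists2 q : forall i, X i,
  w = word q (projT1 w) & forall i, (projT1 w <= i)%N -> q i = p i.
Proof.
case: w => n w /=.
pose q i : X i := match boolP (i < n)%N with
  AltTrue h => w (Ordinal h) | AltFalse _ => p i end.
exists q.
  congr existT; apply: functional_extensionality_dep => -[i lt_i].
  rewrite /q /=; case: {-}_ / boolP => [h|]; last by rewrite lt_i.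
  by rewrite (bool_irrelevance h lt_i).
move=> i ni; rewrite /q; case: {-}_ / boolP => // h.
by have := leq_trans h ni; rewrite ltnn.
Qed.

Lemma box_wordP C m p n : box C m (word p n) <->
  (n <= m)%N /\ forall i, (i < n)%N -> C i (p i).
Proof.
split=> -[nm Cp]; split=> //; last by case=> i lt_i; exact: Cp.
by move=> i lt_i; exact: (Cp (Ordinal lt_i)).
Qed.

Lemma box_word C m w : (forall i, C i !=set0) -> box C m w ->
  exists2 p, w = word p (projT1 w) & forall i, C i (p i).
Proof.
move=> C0 Cw; have [p wE pE] := word_extend w (fun i => sval (cid (C0 i))).
exists p => // i; have [ni|lt_i] := leqP (projT1 w) i.
  by rewrite pE //; exact: (svalP (cid (C0 i))).
by move: Cw; rewrite wE => /box_wordP[_ +]; apply.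
Qed.

Lemma open_level (U : set (hword X)) n :
  open U -> open ([set w | U (existT _ n w)] : set (hprod X n)).
Proof.
rewrite hword_openE => -[->|[V [[oV _] _] ->]]; last exact: oV.
by rewrite (_ : mkset _ = set0); [exact: open0|by apply/seteqP; split].
Qed.

Lemma open_word_box (U : set (hword X)) p n : open U -> U (word p n) ->
  exists V : forall i, set (X i), [/\ forall i, open (V i),
    forall i, V i (p i) &
    forall q, (forall i, (i < n)%N -> V i (q i)) -> U (word q n)].
Proof.
move=> oU Up; have [V [oV Vp VU]] := open_prod_box (open_level n oU) Up.
pose W i : set (X i) := match pselect (is_true (i < n)%N) with
  left lt_i => V (Ordinal lt_i) | right _ => setT end.
exists W; split=> [i|i|q Wq]; rewrite ?/W.
- by case: pselect => lt_i; [exact: oV|exact: openT].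
- by case: pselect => lt_i //; exact: (Vp (Ordinal lt_i)).
apply: VU => -[i lt_i]; have := Wq i lt_i; rewrite /W /=.
by case: pselect => // lt_i'; rewrite (bool_irrelevance lt_i' lt_i).
Qed.

(** Two open sets that meet the box meet it in words of the maximal length [m],
by extension.  Around these, they contain products of open sets which meet the
irreducible factors, so a common letter can be chosen for each [i]. *)
Lemma box_irreducible C m : (forall i, irreducible (C i)) ->
  irreducible (box C m).
Proof.
move=> irrC; have C0 i : C i !=set0 by have [] := irrC i.
apply/irreducible_openP; split.
  pose p i := sval (cid (C0 i)); exists (word p 0).
  by apply/box_wordP; split.
have boxm (U : set (hword X)) : open U -> box C m `&` U !=set0 ->
    exists V : forall i, set (X i), [/\ forall i, open (V i),
      forall i, C i `&` V i !=set0 &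
      forall q, (forall i, (i < m)%N -> V i (q i)) -> U (word q m)].
  move=> oU [u [Cu Uu]]; have [p uE Cp] := box_word C0 Cu.
  have Up : U (word p m) by apply: (open_word oU Cu.1); rewrite -uE.
  have [V [oV Vp VU]] := open_word_box oU Up.
  by exists V; split=> // i; exists (p i).
move=> U V oU oV /(boxm _ oU)[U' [oU' CU' U'U]] /(boxm _ oV)[V' [oV' CV' V'V]].
have CUV i : C i `&` (U' i `&` V' i) !=set0.
  by apply: ((irreducible_openP _).1 (irrC i)).2.
pose z i := sval (cid (CUV i)).
have zP i : (C i `&` (U' i `&` V' i)) (z i) := svalP (cid (CUV i)).
exists (word z m); split.
  by apply/box_wordP; split=> // i _; case: (zP i).
by split; [apply: U'U|apply: V'V] => i _; case: (zP i) => _ [].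
Qed.

Lemma subset_box C D m n : (m <= n)%N ->
  (forall i, (i < m)%N -> C i `<=` D i) -> box C m `<=` box D n.
Proof.
move=> mn CD w [wm Cw]; split=> [|i]; first exact: leq_trans mn.
by apply: CD (Cw i); exact: leq_trans wm.
Qed.

Lemma sub_boxP C D m n : (forall i, C i !=set0) -> box C m `<=` box D n ->
  (m <= n)%N /\ forall i, (i < m)%N -> C i `<=` D i.
Proof.
move=> C0 CD; pose p i := sval (cid (C0 i)).
have Cp i : C i (p i) := svalP (cid (C0 i)).
split; first by have /CD/box_wordP[] : box C m (word p m) by apply/box_wordP.
move=> i im x Cx.
have /CD/box_wordP[_ /(_ i im)] : box C m (word (@dfwith nat X p i x) m).
  by apply/box_wordP; split=> // j _; case: dfwithP.
by rewrite dfwithin.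
Qed.

(** Let [L] be the maximal length of a word in [F], and for [i < L] let [C i] be
the closure of the set of [i]-th letters of the words in [F].  If [w] is in the
box and not in [F], a product of open sets around [w] avoids [F].  Each of its
factors contains the letter of a word in [F], so by irreducibility a single
word [v] in [F] has all its first letters in this product; but then a prefix
of [v], and hence [v], is outside of [F].  The family [C0] supplies the
factors from the [L]-th on, and the letters of words beyond their length. *)
Lemma irreducible_box (F : set (hword X)) (C0 : forall i, irr_closed (X i)) :
  closed F -> irreducible F -> F <> setT ->
  exists m (C : forall i, irr_closed (X i)), F = box (fun i => sval (C i)) m.
Proof.
move=> clF irrF FT.
have [F0 FI] := (irreducible_openP F).1 irrF.
have [N FN] : exists N, forall w, F w -> (projT1 w <= N)%N.
  have := closed_openC clF; rewrite hword_openE => -[FC0|[U [tU [N UN]] FU]].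
    by case: FT; rewrite -[F]setCK FC0 setC0.
  exists N => w Fw; rewrite leqNgt; apply/negP => /ltnW Nw.
  suff : (~` F) w by [].
  by rewrite FU /tfloor /= (wide_telescope_ge tU UN Nw).
have [w0 Fw0] := F0.
have exL : exists n, `[< exists2 w, F w & projT1 w = n >].
  by exists (projT1 w0); apply/asboolP; exists w0.
have leN n : `[< exists2 w, F w & projT1 w = n >] -> (n <= N)%N.
  by move=> /asboolP[w /FN wN <-].
case: (ex_maxnP exL leN) => L /asboolP[wL FwL wLE] Lmax.
have FL w : F w -> (projT1 w <= L)%N.
  by move=> Fw; apply: Lmax; apply/asboolP; exists w.
pose A i := [set x | exists2 w, F w & letter_in [set x] w] : set (X i).
have A_meet i (V : set (X i)) :
    A i `&` V !=set0 ->
    F `&` (letter_in V `|` [set w | (L < projT1 w)%N]) !=set0.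
  move=> [x [[w Fw [lt_i wx]] Vx]]; exists w; split=> //; left; exists lt_i.
  by rewrite wx.
have letter_A i (V : set (X i)) w : F w -> letter_in V w ->
  exists2 x, A i x & V x.
  move=> Fw [lt_i Vw]; exists (letter w (Ordinal lt_i)) => //.
  by exists w => //; exists lt_i.
have irrA i : (i < L)%N ->
    closed (closure (A i)) /\ irreducible (closure (A i)).
  move=> iL; split; first exact: closed_closure.
  apply: irreducible_closure => [|U V oU oV /A_meet FU /A_meet FV].
    have iwL : (i < projT1 wL)%N by rewrite wLE.
    by have [|x Ax _] := letter_A i setT wL FwL; [exists iwL|exists x].
  have [w [Fw [Uw Vw]]] :=
    FI _ _ (open_letter_in L oU) (open_letter_in L oV) FU FV.
  have wNL : ~ (L < projT1 w)%N by rewrite ltnNge FL.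
  case: Uw => // -[lt_i Uw]; case: Vw => // -[lt_i' Vw].
  exists (letter w (Ordinal lt_i)); split; first by exists w => //; exists lt_i.
  by split=> //; rewrite (bool_irrelevance lt_i lt_i').
have exC i : exists C : irr_closed (X i), (i < L)%N -> sval C = closure (A i).
  have [iL|iL] := pselect (is_true (i < L)%N); last by exists (C0 i).
  by exists (exist _ (closure (A i)) (irrA i iL)).
pose C i := sval (cid (exC i)).
have CE i : (i < L)%N -> sval (C i) = closure (A i) := svalP (cid (exC i)).
exists L, C; apply/seteqP; split=> w.
  move=> Fw; split; first exact: FL.
  move=> [i lt_i]; rewrite CE; last exact: leq_trans lt_i (FL w Fw).
  by apply: subset_closure; exists w => //; exists lt_i.
move=> Cw; apply: contrapT => nFw.
have wL' := Cw.1.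
have oFC := closed_openC clF.
have [q wE _] := word_extend w (fun i => sval (cid (svalP (C0 i)).2.1)).
have nFq : (~` F) (word q (projT1 w)) by rewrite -wE.
have [V [oV Vq VF]] := open_word_box oFC nFq.
have [i iw|i iw|v Fv Vv] := irreducible_bigcap (n := projT1 w) irrF
    (U := fun i => letter_in (V i) `|` [set w | (L < projT1 w)%N]).
- exact: open_letter_in.
- apply: A_meet; have iL : (i < L)%N by exact: leq_trans wL'.
  have : closure (A i) (q i).
    by rewrite -CE //; move: Cw; rewrite wE => /box_wordP[_]; apply.
  by apply; apply: open_nbhs_nbhs; split; [exact: oV|exact: Vq].
have {}Vv i : (i < projT1 w)%N -> letter_in (V i) v.
  by case/Vv => //=; rewrite ltnNge FL.
have wv : (projT1 w <= projT1 v)%N.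
  case: (projT1 w) Vv => // n Vv; by have [lt_n _] := Vv n (ltnSn n).
have [r vE _] := word_extend v q.
suff : (~` F) (word r (projT1 v)) by rewrite -vE; apply.
apply: (open_word oFC wv); apply: VF => i iw.
by move: (Vv i iw); rewrite vE => -[].
Qed.

End Words.

(** * The rank of a box *)

Section WordRank.
Variable X : nat -> topologicalType.
Hypotheses (nX : forall n, noetherian (X n)) (X0 : forall n, [set: X n] !=set0).
Implicit Types C D : forall i, irr_closed (X i).

Let R (F G : irr_closed (hword X)) := sval F `<` sval G.
Let rk i := irr_rank (@nX i).

Definition irr_box C m : irr_closed (hword X) := exist _
  (box (fun i => sval (C i)) m)
  (conj (box_closed (m := m) (fun i => (svalP (C i)).1))
        (box_irreducible m (fun i => (svalP (C i)).2))).

Definition irr_top : irr_closed (hword X) :=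
  exist _ setT (conj closedT (setT_irreducible X0)).

Let C_neq0 C i : sval (C i) !=set0 := (svalP (C i)).2.1.

(** A factor counts for the successor of its rank, so that an additional factor
makes a difference even when its rank is [0]. *)
Let box_measure (F : irr_closed (hword X)) a := exists C m,
  F = irr_box C m /\ a = onsums (fun i => osucc (rk (C i))) m.

Lemma box_measure_lt F G a : box_measure F a -> R G F ->
  exists2 b, box_measure G b & olt b a.
Proof.
move=> [C [m [-> ->]]] [] /= GC nCG.
have [clG irrG] := svalP G.
have [GT|m' [D GE]] := irreducible_box C clG irrG.
  by apply: nCG; rewrite GT.
exists (onsums (fun i => osucc (rk (D i))) m').
  by exists D, m'; split=> //; exact: irr_closed_eq.
move: GC nCG; rewrite GE => /(sub_boxP (C_neq0 D))[m'm DC] nCD.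
have rkDC i : (i < m')%N -> ole (osucc (rk (D i))) (osucc (rk (C i))).
  by move=> im'; apply: ole_succ2; apply: irr_rank_ole; exact: DC.
move: (m'm); rewrite leq_eqVlt => /orP[/eqP mE|m'ltm]; last first.
  by apply: olt_onsums_ltn => // i; apply/olt_succP; exact: ole0.
apply: olt_onsums => //; apply: contrapT => H; apply: nCD.
apply: subset_box => [|i im]; first by rewrite mE.
apply: contrapT => nCDi.
apply: H; exists i; first by rewrite mE.
apply/olt_succP/ole_succP/irr_rank_olt; split=> //.
by apply: DC; rewrite mE.
Qed.

Lemma acc_box C m : Acc R (irr_box C m).
Proof. by apply: (acc_measure box_measure_lt); exists C, m. Qed.

Lemma below_topE (C0 : forall i, irr_closed (X i)) F :
  R F irr_top -> exists C m, F = irr_box C m.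
Proof.
move=> [_ nTF]; have [clF irrF] := svalP F.
have [FT|m [C FE]] := irreducible_box C0 clF irrF.
  by apply: nTF; rewrite FT.
by exists C, m; exact: irr_closed_eq.
Qed.

Lemma acc_top (C0 : forall i, irr_closed (X i)) : Acc R irr_top.
Proof. by constructor=> F /(below_topE C0)[C [m ->]]; exact: acc_box. Qed.

Lemma rank_box_le C m (a : Acc R (irr_box C m)) :
  ole (acc_rank a) (iter m osucc (onsums (fun i => rk (C i)) m)).
Proof.
apply: ole_trans (onsums_succ _ _).
by apply: (acc_rank_measure box_measure_lt); exists C, m.
Qed.

(** By well-founded induction: an ordinal below the natural sum is below the sum
in which one rank, say that of [D i], is decreased.  The smaller rank is
bounded by that of an irreducible closed proper subset of [D i], which gives a
smaller box. *)
Lemma rank_box_ge C m (a : Acc R (irr_box C m)) :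
  ole (onsums (fun i => rk (C i)) m) (acc_rank a).
Proof.
suff H F : Acc R F -> forall D (aF : Acc R F), F = irr_box D m ->
    ole (onsums (fun i => rk (D i)) m) (acc_rank aF) by exact: H.
move=> accF; elim: accF => {}F _ IH {a}D aF FE; apply: ole_lt => c.
move=> /olt_onsumsP[i [a [im aD]]].
have [E [ED nDE] aE] := olt_irr_rank aD.
pose D' := @dfwith nat (fun i => irr_closed (X i)) D i E.
have D'F : R (irr_box D' m) F.
  rewrite FE; split=> /=.
    by apply: subset_box => // j _; rewrite /D'; case: dfwithP => [|? _] //.
  move=> /(sub_boxP (C_neq0 D))[_ /(_ i im)].
  by rewrite /D' dfwithin.
move=> /(_ (fun j => rk (D' j))) cD'.
apply: ole_olt_trans (acc_rank_mono aF (acc_box D' m) D'F).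
apply: ole_trans (IH _ D'F D' (acc_box D' m) erefl); apply: cD'.
  by rewrite /D' dfwithin.
by move=> j; rewrite /D'; case: dfwithP => [/eqP//|*]; exact: ole_refl.
Qed.

Lemma box_extend_lt C m : R (irr_box C m) (irr_box C m.+1).
Proof.
split=> /=; first by apply: subset_box => // i _ x.
by move=> /(sub_boxP (C_neq0 C))[]; rewrite ltnn.
Qed.

Lemma box_top_lt C m : R (irr_box C m) irr_top.
Proof.
split=> //= TC; have [_] := box_extend_lt C m.
by apply=> w _; exact: TC.
Qed.

(** The two parts say that the reduced rank is the least ordinal strictly above
all the finite successors of the partial sums.  For the lower bound, [n] more
factors raise the rank of a box by at least [n]; for the upper bound, the
[m]-th successor of the [m]-th sum is enough. *)
Lemma rsob_hword_bounds : let r i := rsob (X i) in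
  (forall m n, olt (iter n osucc (onsums r m)) (rsob (hword X))) /\
  (forall b, (forall m, olt (iter m osucc (onsums r m)) b) ->
    ole (rsob (hword X)) b).
Proof.
move=> r; pose C0 i := sval (cid (rsob_attained (@nX i) (X0 i))).
have C0r i : oeq (r i) (rk (C0 i)).
  exact: (svalP (cid (rsob_attained (@nX i) (X0 i)))).
have [topL topR] : oeq (rsob (hword X)) (acc_rank (acc_top C0)).
  apply: opred_ord_rank => F aF.
  have [FT|FT] := pselect (sval F `<` setT).
    by apply: oltW; exact: acc_rank_mono.
  have FE : F = irr_top.
    apply/irr_closed_eq/seteqP; split=> //=.
    by apply: contrapT => TF; apply: FT.
  move: aF; rewrite FE => aF.
  by rewrite (Prop_irrelevance aF (acc_top C0)); exact: ole_refl.
split=> [m n|b rb].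
  apply: olt_ole_trans topR.
  apply: ole_olt_trans (acc_rank_mono _ (acc_box C0 (n + m)) (box_top_lt _ _)).
  elim: n => [|n IH]; last first.
    apply/ole_succP; apply: (ole_olt_trans IH).
    exact: acc_rank_mono (box_extend_lt _ _).
  apply: ole_trans (rank_box_ge _); apply: ole_onsums => // i _.
  exact: (C0r i).1.
apply: (ole_trans topL); apply: ole_lt => c ct.
have [F [aF [FT cF]]] := olt_acc_rankP ct.
have [C [m FE]] := below_topE C0 FT; move: aF cF; rewrite FE => aF cF.
apply: ole_olt_trans (rb m); apply: (ole_trans cF).
apply: ole_trans (rank_box_le aF) _; apply: ole_iter_succ.
apply: ole_onsums => // i _; exact: ole_opred_ord_rank.
Qed.

End WordRank.

(** * The reduced sobrification rank of the word space *)

Theorem theorem13p4 (X : nat -> topologicalType)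
    (X_noetherian : forall n, noetherian (X n))
    (X_nonempty : forall n, [set: X n] !=set0) :
  ((\forall n \near \oo, ofinite (rsob (X n))) ->
   forall k : nat,
     (forall n, (k <= n)%N -> ofinite (rsob (X n))) ->
     (forall j, k = j.+1 -> ~ ofinite (rsob (X j))) ->
     oeq (rsob (hword X))
         (oadd (\big[onsum/ozero]_(i < k) rsob (X i)) omega)) /\
  (~ (\forall n \near \oo, ofinite (rsob (X n))) ->
   oeq (rsob (hword X))
       (osup (fun n : nat => \big[onsum/ozero]_(i < n) rsob (X i)))).
Proof.
have [lower upper] := rsob_hword_bounds X_noetherian X_nonempty.
split=> [_ k fin _|inf]; split.
- apply: upper => m.
  have [p hp] := onsums_finite m fin.
  apply: ole_olt_trans (ole_iter_succ m hp) _; rewrite -iterD.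
  exact: ((ole_oadd_omega _ _).1 (ole_refl _)).
- by apply/ole_oadd_omega => n; exact: lower.
- apply: upper => m; apply/olt_osupP.
  (* The [m.+1] successors are absorbed by an infinite term at [j >= m]. *)
  have [j mj infj] : exists2 j, (m <= j)%N & ~ ofinite (rsob (X j)).
    apply: contrapT => H; apply: inf; exists m => // j mj.
    by apply: contrapT => infj; apply: H; exists j.
  exists j.+1; apply/ole_succP.
  exact: (onsums_infinite (a := fun i => rsob (X i)) m.+1 mj infj).
- apply: ole_lt => c /olt_osupP[m cm].
  exact: olt_ole_trans cm (oltW (lower m 0)).
Qed.
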